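(* Let $E=E(n,\alpha,d)$ be the event that throwing $\alpha n$ balls independently and uniformly at random into $n$ bins results in at least $d$ balls in every bin, where $n,d$ are positive integers, $\alpha\ge d$ is real, and $\alpha n$ is an integer. (i) Let $d$ be a fixed positive integer and $\alpha$ a fixed real number with $\alpha>d$. Let $\lambda=\lambda(\alpha,d)$ and $\zeta=\zeta(\alpha,d)$ be the parameter and normalisation factor of the truncated Poisson distribution $\Phi(\alpha,d)$. Then $$\Pr[E]=\Theta(b^n),\qquad b=\frac{\alpha^{\alpha}\,\zeta}{e^{\alpha}\,\lambda^{\alpha-d}},$$ i.e. there are constants $0<c\le C$ depending only on $\alpha$ and $d$ such that $c\,b^n\le \Pr[E]\le C\,b^n$ for all sufficiently large $n$ for which $\alpha n$ is an integer. (ii) If $\alpha=d$, where $d$ is not necessarily constant, then $$\Pr[E]=\Theta\big(b^n\sqrt{dn}\big),\qquad b=\frac{d^d}{e^d\,d!},$$ i.e. there are absolute constants $0<c\le C$ such that $c\,b^n\sqrt{dn}\le\Pr[E]\le C\,b^n\sqrt{dn}$ for all positive integers $n$ and $d$.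
   Context: Formally: $c_1,\dots,c_{\alpha n}$ are independent random variables, each uniformly distributed on $\{1,\dots,n\}$, where $c_j$ is the bin of the $j$-th ball. The load of bin $i$ is $X_i=|\{j\in\{1,\dots,\alpha n\} : c_j=i\}|$ for $1\le i\le n$, and $E=\{\min_{1\le i\le n}X_i\ge d\}$. The distribution $\Phi(\alpha,d)$ is a Poisson distribution truncated to values $\ge d$ and tuned to have expectation $\alpha$: a random variable $Z\sim\Phi(\alpha,d)$ satisfies $\Pr[Z=i]=0$ for $i<d$ and $\Pr[Z=i]=\frac{1}{\zeta}\frac{\lambda^{i-d}}{i!}$ for integers $i\ge d$, where $\zeta=\sum_{i\ge d}\frac{\lambda^{i-d}}{i!}$ and $\lambda=\lambda(\alpha,d)$ is the parameter chosen such that $\mathbb{E}[Z]=\alpha$ (for $\alpha>d$ this is a positive real number). *)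

(* Defs.v *)
From HB Require Import structures.
From mathcomp Require Import all_boot all_order all_algebra.
From mathcomp Require Import all_classical all_reals all_analysis.
Set Implicit Arguments.
Unset Strict Implicit.
Unset Printing Implicit Defensive.
Import Order.TTheory GRing.Theory Num.Theory.
Import numFieldNormedType.Exports.
Local Open Scope classical_set_scope.
Local Open Scope ring_scope.

Section BallsInBins.
Context {R : realType} {disp : measure_display} {T : measurableType disp}.
Context (P : probability T R) {n m : nat}.

(* A ball is a map from outcomes to bins. The bins carry the discrete
   sigma-algebra and are finitely many, so measurability amounts to
   measurability of the fibres. *)
Definition ball_rv (c : T -> 'I_n) : Prop :=
  forall i : 'I_n, measurable (c @^-1` [set i]).

Definition uniform_ball (c : T -> 'I_n) : Prop :=
  forall i : 'I_n, P (c @^-1` [set i]) = (n%:R^-1)%:E.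

Definition independent_balls (ball : 'I_m -> T -> 'I_n) : Prop :=
  forall (J : {set 'I_m}) (A : 'I_m -> set 'I_n),
    P (\bigcap_(j in [set` J]) (ball j @^-1` A j)) =
    (\prod_(j in J) P (ball j @^-1` A j))%E.

Definition random_throw (ball : 'I_m -> T -> 'I_n) : Prop :=
  [/\ forall j, ball_rv (ball j),
      forall j, uniform_ball (ball j)
    & independent_balls ball].

Definition load (ball : 'I_m -> T -> 'I_n) (i : 'I_n) (w : T) : nat :=
  #|[pred j : 'I_m | ball j w == i]|.

Definition all_loads_ge (d : nat) (ball : 'I_m -> T -> 'I_n) : set T :=
  [set w | forall i : 'I_n, (d <= load ball i w)%N].

End BallsInBins.

Section TruncatedPoisson.
Context {R : realType}.
Implicit Types (d i : nat) (alpha l : R).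

Definition tpoisson_zeta d l : R :=
  \big[+%R/0]_(d <= i <oo) (l ^+ (i - d) / i`!%:R).

Definition tpoisson_pmf d l i : R :=
  if (i < d)%N then 0 else (tpoisson_zeta d l)^-1 * (l ^+ (i - d) / i`!%:R).

Definition tpoisson_mean d l : \bar R :=
  (\sum_(0 <= i <oo) (i%:R * tpoisson_pmf d l i)%:E)%E.

(* [l = 0] is admitted because it gives the point mass at [d]; when
   [d%:R < alpha] the parameter is automatically positive. The default value 0
   of [xget] is only used if no parameter has mean [alpha]. *)
Definition tpoisson_lambda alpha d : R :=
  xget 0 [set l | 0 <= l /\ tpoisson_mean d l = alpha%:E].

End TruncatedPoisson.

(* Main.v *)
(* The number of throws of m balls into n bins with all loads at least d is m!
   times the coefficient of X^m in (sum_(i >= d) X^i / i!)^n. Tilting by lambda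
   turns this into m! zeta^n lambda^(dn - m) Pr[Z_1 + ... + Z_n = m], where the Z_i
   are independent with law Phi(alpha, d), so by Stirling's formula Pr[E] is
   b^n sqrt(m) Pr[Z_1 + ... + Z_n = m] up to a constant factor. For alpha = d the
   coefficient is 1 / d!^n. For alpha > d it remains to see that the last
   probability is of order 1 / sqrt n. Write the law of Z - d as a mixture that is,
   with some probability q > 0, a fair bit. Given the number K of bits and the sum u
   of the other terms, the probability is C(K, k - u) / 2^K with k = m - dn. By
   Chebyshev's inequality K is of order n, which gives the upper bound, and with
   probability at least 1/2 also k - u is within O(sqrt n) of K / 2, where the
   binomial weight is at least a constant over sqrt n. *)
Require Import Defs.
From HB Require Import structures.
From mathcomp Require Import all_boot all_order all_algebra.
From mathcomp Require Import all_classical all_reals all_analysis.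
From mathcomp Require Import ring lra zify.
Import Order.TTheory GRing.Theory Num.Theory.
Import numFieldNormedType.Exports.
Local Open Scope classical_set_scope.
Local Open Scope ring_scope.

(** * Logarithm bounds and Stirling's formula with explicit constants *)

Lemma ge0_is_derive {R : realType} (f df : R -> R) (x : R) :
  f 0 = 0 -> (forall y : R, 0 <= y -> is_derive y 1 f (df y)) ->
  (forall y : R, 0 <= y -> 0 <= df y) -> 0 <= x -> 0 <= f x.
Proof.
move=> f0 fE df0 x0; rewrite -f0.
apply: (@ger0_derive1_ndecry _ f 0) => //.
- move=> y; rewrite in_itv/= andbT => /ltW y0.
  by have [] := fE y y0.
- move=> y; rewrite in_itv/= andbT => /ltW y0.
  by have fy := fE y y0; rewrite derive1E derive_val df0.
- apply: derivable_within_continuous => y.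
  by rewrite in_itv/= andbT => y0; have [] := fE y y0.
Qed.

(** The difference vanishes at 0 and has the nonnegative derivative [df]. This rational bound is
    chosen because at [x = 1/m] its product with [m + 1/2] is exactly 1. *)
Lemma ln1D_ge {R : realType} (x : R) : 0 <= x -> 2 * x / (2 + x) <= ln (1 + x).
Proof.
move=> x0; rewrite -subr_ge0.
pose f (y : R) := ln (1 + y) - 2 * y * (2 + y)^-1.
pose df (y : R) := y ^+ 2 / ((1 + y) * (2 + y) ^+ 2).
apply: (@ge0_is_derive _ f df) => // [|y y0|y y0].
- by rewrite /f addr0 ln1 mulr0 mul0r subrr.
- have y1 : 0 < 1 + y by lra.
  have y2 : 2 + y != 0 by lra.
  have := @is_derive1_ln _ (1 + y) y1 => ln_deriv.
  rewrite /f; apply: is_derive_eq.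
  by rewrite /df /GRing.scale/=; field; rewrite y2 lt0r_neq0.
- by rewrite /df divr_ge0// ?exprn_ge0// mulr_ge0 ?exprn_ge0//; lra.
Qed.

(** The cubic term is kept because at [x = 1/m] the product with [m + 1/2] then exceeds 1 only by a
    quantity of order [1/m^2], small enough to telescope. *)
Lemma ln1D_le {R : realType} (x : R) :
  0 <= x -> ln (1 + x) <= x - x ^+ 2 / 2 + x ^+ 3 / 3.
Proof.
move=> x0; rewrite -subr_ge0.
pose f (y : R) := y - y ^+ 2 / 2 + y ^+ 3 / 3 - ln (1 + y).
pose df (y : R) := y ^+ 3 / (1 + y).
apply: (@ge0_is_derive _ f df) => // [|y y0|y y0].
- by rewrite /f addr0 ln1 !expr0n/= !mul0r !subr0 addr0.
- have y1 : 0 < 1 + y by lra.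
  have := @is_derive1_ln _ (1 + y) y1 => ln_deriv.
  rewrite /f; apply: is_derive_eq.
  by rewrite /df /GRing.scale/=; field; rewrite lt0r_neq0.
- by rewrite /df divr_ge0// ?exprn_ge0//; lra.
Qed.

(* With [t] as below, [t] is nonincreasing in [m] and [t - 1/(2m)] is
   nondecreasing, by the two bounds on [ln (1 + 1/m)]; both are known at [m = 1]. *)
Lemma ln_stirling {R : realType} (m : nat) : (0 < m)%N ->
  let t : R := ln m`!%:R + m%:R - (m%:R + 2^-1) * ln m%:R in
  2^-1 + (2 * m%:R)^-1 <= t /\ t <= 1.
Proof.
case: m => // m _ /=; elim: m => [|m [IHl IHr]].
  by rewrite (_ : 1`! = 1)%N// ln1; split; lra.
set M : R := m.+1%:R in IHl IHr *.
have M0 : 0 < M by rewrite ltr0n.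
have M3 : 1 <= M by rewrite ler1n.
have SM : m.+2%:R = M + 1 :> R by rewrite -natr1.
have fE : ln (m.+2)`!%:R = ln (m.+1)`!%:R + ln (M + 1) :> R.
  rewrite factS natrM mulrC lnM ?posrE ?ltr0n ?fact_gt0//.
  by rewrite SM.
rewrite SM fE => {SM fE}; move: M M0 M3 IHl IHr => M M0 M3 IHl IHr.
have i0 : 0 < M^-1 by rewrite invr_gt0.
have lE : ln (M + 1) = ln M + ln (1 + M^-1).
  have i1 : 0 < 1 + M^-1 by lra.
  by rewrite -lnM ?posrE// mulrDr mulr1 mulfV ?lt0r_neq0.
rewrite lE.
have lo : 1 <= (M + 2^-1) * ln (1 + M^-1).
  have H := ln1D_ge _ (ltW i0).
  apply: (le_trans _ (ler_wpM2l _ H)); last lra.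
  by rewrite le_eqVlt; apply/orP; left; apply/eqP; field; lra.
have hi : (M + 2^-1) * ln (1 + M^-1) <= 1 + (2 * M)^-1 - (2 * (M + 1))^-1.
  have H := ln1D_le _ (ltW i0).
  have M2 : 0 <= M + 2^-1 by lra.
  apply: (le_trans (ler_wpM2l M2 H)); rewrite -subr_ge0.
  (* The numerator factors as [(5 * M + 2) * (M - 1)], so [1 <= M] suffices, with equality at the
     start of the induction. *)
  rewrite [X in 0 <= X](_ : _ =
    (5 * M ^+ 2 - 3 * M - 2) / (12 * M ^+ 3 * (M + 1))); last first.
    by field; rewrite !lt0r_neq0 //; lra.
  apply: divr_ge0; first by nra.
  by rewrite !mulr_ge0 ?exprn_ge0//; lra.
split; last nra.
have -> : (2 * (M + 1))^-1 = (2 * M)^-1 - ((2 * M)^-1 - (2 * (M + 1))^-1) by ring.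
nra.
Qed.

(** Exponentiates [ln_stirling], dropping the positive term [1/(2m)] from the lower bound so that
    both constants are absolute. *)
Lemma stirling {R : realType} (m : nat) : (0 < m)%N ->
  let s : R := Num.sqrt m%:R * (m%:R ^+ m / expR m%:R) in
  expR 2^-1 * s <= m`!%:R /\ m`!%:R <= expR 1 * s.
Proof.
move=> m0 /=.
have [lo hi] := @ln_stirling R m m0.
have M0 : 0 < m%:R :> R by rewrite ltr0n.
have f0 : 0 < m`!%:R :> R by rewrite ltr0n fact_gt0.
have -> : Num.sqrt m%:R * (m%:R ^+ m / expR m%:R) =
    expR ((m%:R + 2^-1) * ln m%:R - m%:R) :> R.
  rewrite expRB mulrDl expRD.
  rewrite mulr_natl -lnXn// lnK ?posrE ?exprn_gt0//.
  rewrite -ln_powR powR12_sqrt// lnK ?posrE ?sqrtr_gt0//.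
  by rewrite [RHS]mulrAC [RHS]mulrC.
rewrite -!expRD -[m`!%:R]lnK ?posrE// !ler_expR; split; last lra.
by have : 0 < (2 * m%:R)^-1 :> R by [rewrite invr_gt0 mulr_gt0]; lra.
Qed.

(** * Upper and lower bounds for symmetric binomial weights *)

Lemma bin_le_mid (K j : nat) : ('C(K, j) <= 'C(K, K./2))%N.
Proof.
have step i : (i < K./2)%N -> ('C(K, i) <= 'C(K, i.+1))%N.
  move=> iK; have := mul_bin_left K i => H.
  rewrite -(leq_pmul2l (ltn0Sn i)) H leq_mul2r; apply/orP; right; lia.
have mono i k : (i + k <= K./2)%N -> ('C(K, i) <= 'C(K, i + k))%N.
  elim: k => [|k IH] ik; first by rewrite addn0.
  by rewrite addnS (leq_trans (IH _) (step _ _))//; lia.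
have low i : (i <= K./2)%N -> ('C(K, i) <= 'C(K, K./2))%N.
  by move=> iK; rewrite -[X in (_ <= 'C(_, X))%N](subnKC iK) mono//; lia.
have [/low//|jK] := leqP j K./2.
have [jK'|jK'] := leqP j K; last by rewrite bin_small.
by rewrite -bin_sub// low//; lia.
Qed.

Section BinomialTails.
Context {R : realType}.
Variables (a b : nat).
Hypotheses (a0 : (0 < a)%N) (b0 : (0 < b)%N).
Let A : R := a%:R.
Let B : R := b%:R.
Let K : R := (a + b)%:R.
Let A0 : 0 < A. Proof. by rewrite ltr0n. Qed.
Let B0 : 0 < B. Proof. by rewrite ltr0n. Qed.
Let KE : K = A + B. Proof. by rewrite /K natrD. Qed.
Let K0 : 0 < K. Proof. by rewrite KE addr_gt0. Qed.
Let K20 : 0 <= K / 2. Proof. by rewrite divr_ge0 ?ltW. Qed.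

(* Both entropy bounds come from [x <= expR (x - 1)], applied to [K / (2 c)] here
   and to [2 c / K] in [entropy_ge], for [c = a] and [c = b]. *)
Lemma entropy_le : (K / 2) ^+ (a + b) <= A ^+ a * B ^+ b.
Proof.
have aux (c : nat) : (0 < c)%N ->
    (K / 2) ^+ c <= c%:R ^+ c * expR (K / 2 - c%:R).
  move=> c0; have C0 : 0 < c%:R :> R by rewrite ltr0n.
  have -> : K / 2 - c%:R = (K / (2 * c%:R) - 1) * c%:R by field; rewrite -?natrD lt0r_neq0.
  rewrite expRM_natr -exprMn lerXn2r ?nnegrE ?mulr_ge0 ?expR_ge0 ?(ltW C0)//.
  have := expR_ge1Dx (K / (2 * c%:R) - 1); rewrite addrC subrK => H.
  apply: le_trans (ler_wpM2l (ltW C0) H).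
  by rewrite le_eqVlt; apply/orP; left; apply/eqP; field; rewrite -?natrD lt0r_neq0.
rewrite exprD; apply: (le_trans (ler_pM _ _ (aux _ a0) (aux _ b0))).
- by rewrite exprn_ge0.
- by rewrite exprn_ge0.
rewrite mulrACA -expRD (_ : K / 2 - _ + _ = 0); last by rewrite KE /A /B; field.
by rewrite expR0 mulr1.
Qed.

Lemma entropy_ge :
  A ^+ a * B ^+ b <= (K / 2) ^+ (a + b) * expR ((A - B) ^+ 2 / K).
Proof.
have aux (c : nat) : (0 < c)%N ->
    c%:R ^+ c <= (K / 2) ^+ c * expR (c%:R * (2 * c%:R - K) / K).
  move=> c0; have C0 : 0 < c%:R :> R by rewrite ltr0n.
  have -> : c%:R * (2 * c%:R - K) / K = (2 * c%:R / K - 1) * c%:R.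
    by field; rewrite -?natrD lt0r_neq0.
  rewrite expRM_natr -exprMn lerXn2r ?nnegrE ?mulr_ge0 ?expR_ge0 ?ler0n//.
  have := expR_ge1Dx (2 * c%:R / K - 1); rewrite addrC subrK => H.
  apply: le_trans (ler_wpM2l K20 H).
  by rewrite le_eqVlt; apply/orP; left; apply/eqP; field; rewrite -?natrD lt0r_neq0.
apply: (le_trans (ler_pM _ _ (aux _ a0) (aux _ b0))); rewrite ?exprn_ge0 ?ler0n//.
rewrite mulrACA -expRD -exprD ler_wpM2l ?exprn_ge0//.
rewrite ler_expR le_eqVlt; apply/orP; left; apply/eqP.
by rewrite KE -/A -/B; field; rewrite -?natrD lt0r_neq0.
Qed.

Let s (m : nat) : R := Num.sqrt m%:R * (m%:R ^+ m / expR m%:R).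

(** With Stirling's approximations in place of the factorials the exponentials cancel; a square-root
    factor and the quotient estimated by the entropy bounds remain. *)
Let sE : s (a + b) / (s a * s b) / 2 ^+ (a + b) =
  Num.sqrt K / (Num.sqrt A * Num.sqrt B) * ((K / 2) ^+ (a + b) / (A ^+ a * B ^+ b)).
Proof.
rewrite /s -/K -/A -/B KE expRD -KE expr_div_n.
have h1 : Num.sqrt A != 0 by rewrite lt0r_neq0// sqrtr_gt0.
have h2 : Num.sqrt B != 0 by rewrite lt0r_neq0// sqrtr_gt0.
have h3 : expR A != 0 by rewrite lt0r_neq0// expR_gt0.
have h4 : expR B != 0 by rewrite lt0r_neq0// expR_gt0.
have h5 : A ^+ a != 0 by rewrite lt0r_neq0// exprn_gt0.
have h6 : B ^+ b != 0 by rewrite lt0r_neq0// exprn_gt0.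
have h7 : (2 : R) ^+ (a + b) != 0 by rewrite lt0r_neq0// exprn_gt0.
move: (Num.sqrt A) (Num.sqrt B) (Num.sqrt K) (expR A) (expR B) (A ^+ a) (B ^+ b)
  (2 ^+ (a + b)) (K ^+ (a + b)) h1 h2 h3 h4 h5 h6 h7.
by move=> u1 u2 u3 u4 u5 u6 u7 u8 u9 *; field; do ?[apply/andP; split].
Qed.

Let s_gt0 (m : nat) : (0 < m)%N -> 0 < s m.
Proof.
move=> m0; rewrite /s mulr_gt0 ?sqrtr_gt0 ?ltr0n// divr_gt0 ?expR_gt0//.
by rewrite exprn_gt0// ltr0n.
Qed.

Let P0 : 0 < s a * s b. Proof. exact: mulr_gt0 (s_gt0 _ a0) (s_gt0 _ b0). Qed.
Let S0 : 0 < s (a + b). Proof. exact: s_gt0 (ltn_addr b a0). Qed.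

Let binE : 'C(a + b, a)%:R = (a + b)`!%:R / (a`!%:R * b`!%:R) :> R.
Proof.
rewrite -(bin_fact (leq_addr b a)) addKn !natrM mulfK// mulf_neq0// pnatr_eq0 -lt0n fact_gt0.
Qed.

Lemma bin_stirling_le :
  'C(a + b, a)%:R / 2 ^+ (a + b) <= Num.sqrt K / (Num.sqrt A * Num.sqrt B).
Proof.
have [_ hK] := @stirling R (a + b) (ltn_addr b a0).
have [hA _] := @stirling R a a0.
have [hB _] := @stirling R b b0.
apply: (@le_trans _ _ (s (a + b) / (s a * s b) / 2 ^+ (a + b))).
  rewrite ler_wpM2r ?invr_ge0 ?exprn_ge0// binE.
  rewrite ler_pdivrMr ?mulr_gt0 ?ltr0n ?fact_gt0//; apply: (le_trans hK).
  rewrite -/(s (a + b)) [leRHS]mulrAC ler_pdivlMr ?P0//.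
  rewrite [leLHS]mulrAC [leRHS]mulrC ler_wpM2r ?(ltW S0)//.
  (* The constant [e] lost in the numerator is exactly the product of the two constants [e^(1/2)]
     gained in the denominator. *)
  have e0 : expR 1 = expR 2^-1 * expR 2^-1 :> R by rewrite -expRD; congr expR; lra.
  rewrite e0 mulrACA; apply: ler_pM => //.
  - exact: mulr_ge0 (expR_ge0 _) (ltW (s_gt0 _ a0)).
  - exact: mulr_ge0 (expR_ge0 _) (ltW (s_gt0 _ b0)).
rewrite sE ler_piMr// ?divr_ge0 ?mulr_ge0 ?sqrtr_ge0//.
by rewrite ler_pdivrMr ?mul1r ?entropy_le// mulr_gt0// exprn_gt0.
Qed.

Lemma bin_stirling_ge :
  expR (- (3 / 2)) * (Num.sqrt K / (Num.sqrt A * Num.sqrt B)) *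
    expR (- ((A - B) ^+ 2 / K)) <= 'C(a + b, a)%:R / 2 ^+ (a + b).
Proof.
have [hK _] := @stirling R (a + b) (ltn_addr b a0).
have [_ hA] := @stirling R a a0.
have [_ hB] := @stirling R b b0.
apply: (@le_trans _ _ (expR (- (3 / 2)) * (s (a + b) / (s a * s b) / 2 ^+ (a + b)))).
  rewrite sE -mulrA ler_wpM2l ?expR_ge0// ler_wpM2l ?divr_ge0 ?mulr_ge0 ?sqrtr_ge0//.
  rewrite expRN ler_pdivlMr ?mulr_gt0 ?exprn_gt0// mulrC ler_pdivrMr ?expR_gt0//.
  exact: entropy_ge.
rewrite mulrA ler_wpM2r ?invr_ge0 ?exprn_ge0// binE.
rewrite ler_pdivlMr ?mulr_gt0 ?ltr0n ?fact_gt0//; apply: le_trans hK.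
rewrite -/(s (a + b)).
have -> : expR 2^-1 * s (a + b) =
    expR (- (3 / 2)) * (s (a + b) / (s a * s b)) * (expR 1 * s a * (expR 1 * s b)).
  (* Here the numerator gains [e^(1/2)] and each factorial below loses [e], which leaves
     [e^(-3/2)]. *)
  have -> : expR 2^-1 = expR (- (3 / 2)) * expR 1 * expR 1 :> R.
    by rewrite -!expRD; congr expR; lra.
  by field; rewrite !lt0r_neq0// s_gt0.
apply: ler_wpM2l.
  exact: mulr_ge0 (expR_ge0 _) (divr_ge0 (ltW S0) (ltW P0)).
apply: ler_pM => //; rewrite mulr_ge0 ?ler0n//.
Qed.

End BinomialTails.

Lemma bin_half_le {R : realType} (K j : nat) : (0 < K)%N ->
  'C(K, j)%:R / 2 ^+ K <= 3 / Num.sqrt K%:R :> R.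
Proof.
move=> K0; have K0' : 0 < K%:R :> R by rewrite ltr0n.
apply: (@le_trans _ _ ('C(K, K./2)%:R / 2 ^+ K)).
  by rewrite ler_wpM2r ?invr_ge0 ?exprn_ge0// ler_nat bin_le_mid.
(* For [K = 1] the half [K./2] is 0, where the Stirling bounds do not apply. *)
have [K1|K1] := leqP K 1.
  have -> : K = 1%N by lia.
  by rewrite sqrtr1 bin0; lra.
have Kh : (0 < K./2)%N by lia.
have Kh' : (0 < K - K./2)%N by lia.
have := @bin_stirling_le R _ _ Kh Kh'.
rewrite subnKC; last lia.
move=> /le_trans; apply.
rewrite ler_pdivlMr ?sqrtr_gt0// mulrAC -expr2 sqr_sqrtr ?ler0n//.
rewrite -sqrtrM ?ler0n// ler_pdivrMr ?sqrtr_gt0 ?mulr_gt0 ?ltr0n//.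
have -> : 3 = Num.sqrt 9 :> R.
  by rewrite (_ : 9 = 3 ^+ 2) ?sqrtr_sqr ?ger0_norm//; lra.
have {1}-> : K%:R = Num.sqrt (K%:R ^+ 2) :> R by rewrite sqrtr_sqr ger0_norm ?ler0n.
rewrite -sqrtrM ?ler0n// ler_sqrt ?mulr_ge0//.
(* What remains is that [K^2] is at most 9 times the product of the two halves of [K], true from
   [K = 2] on. *)
by rewrite -natrX -!natrM ler_nat; nia.
Qed.

(** Since [j (K - j) <= K^2], the square-root factor of [bin_stirling_ge] is at least
    [1 / sqrt K]. *)
Lemma bin_half_ge {R : realType} (K j : nat) : (0 < j < K)%N ->
  expR (- (3 / 2)) / Num.sqrt K%:R * expR (- ((2 * j%:R - K%:R) ^+ 2 / K%:R))
    <= 'C(K, j)%:R / 2 ^+ K :> R.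
Proof.
move=> /andP[j0 jK].
have kj : (0 < K - j)%N by rewrite subn_gt0.
have := @bin_stirling_ge R _ _ j0 kj.
rewrite subnKC; last lia.
rewrite natrB; last lia.
rewrite (_ : j%:R - (K%:R - j%:R) = 2 * j%:R - K%:R :> R); last by ring.
apply: le_trans; rewrite ler_wpM2r ?expR_ge0// ler_wpM2l ?expR_ge0//.
have J0 : 0 < j%:R :> R by rewrite ltr0n.
have JK : 0 < K%:R - j%:R :> R by rewrite subr_gt0 ltr_nat.
have K0 : 0 < K%:R :> R by lra.
rewrite -sqrtrM ?ler0n// ler_pdivlMr ?sqrtr_gt0 ?mulr_gt0//.
rewrite mulrC ler_pdivrMr ?sqrtr_gt0// -expr2 sqr_sqrtr ?ler0n//.
rewrite -[leRHS](@ger0_norm _ K%:R) ?ler0n// -sqrtr_sqr ler_sqrt ?sqr_ge0//.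
nra.
Qed.

(** * Chebyshev's inequality for product weights *)

Section ProductWeights.
Context {R : realType} {Om : finType} (n : nat).
Variables (w g : Om -> R).
Hypothesis w0 : forall o, 0 <= w o.
Hypothesis w1 : \sum_o w o <= 1.

Let mass : R := \sum_o w o.
Let mass0 : 0 <= mass. Proof. by apply: sumr_ge0. Qed.

Lemma sum_prod_weights : \sum_(f : {ffun 'I_n -> Om}) \prod_i w (f i) = mass ^+ n.
Proof.
by rewrite -(bigA_distr_bigA (fun _ : 'I_n => w)) prodr_const card_ord.
Qed.

(** The sum factors over the coordinates. Those other than [i] and [j] contribute a power of [mass],
    which is at most 1; it need not equal 1, as the weights will come from a truncated
    distribution. *)
Let pair_moment (i j : 'I_n) :
  \sum_(f : {ffun 'I_n -> Om}) (\prod_l w (f l)) * (g (f i) * g (f j)) <=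
  (\sum_o w o * g o) ^+ 2 + (if j == i then \sum_o w o * g o ^+ 2 else 0).
Proof.
pose h (l : 'I_n) (o : Om) : R :=
    w o * ((if l == i then g o else 1) * (if l == j then g o else 1)).
have -> : \sum_(f : {ffun 'I_n -> Om}) (\prod_l w (f l)) * (g (f i) * g (f j)) =
    \prod_l \sum_o h l o.
  rewrite bigA_distr_bigA; apply: eq_bigr => f _.
  rewrite /h big_split/= big_split/=; congr (_ * (_ * _)).
    by rewrite (bigD1 i)//= eqxx big1 ?mulr1// => l /negPf ->.
  by rewrite (bigD1 j)//= eqxx big1 ?mulr1// => l /negPf ->.
have rest01 (P : pred 'I_n) : (forall l, P l -> (l != i) && (l != j)) ->
    0 <= \prod_(l | P l) \sum_o h l o <= 1.
  move=> PE; have E l : P l -> \sum_o h l o = mass.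
    move=> /PE/andP[/negPf li /negPf lj]; apply: eq_bigr => o _.
    by rewrite /h li lj !mulr1.
  apply/andP; split; first by apply: prodr_ge0 => l /E ->.
  by apply: prodr_ile1 => l /E ->; rewrite mass0 w1.
rewrite (bigD1 i)//=; have [ij|ij] := eqVneq j i; first subst j.
  have /andP[r0 r1] : 0 <= \prod_(l | l != i) \sum_o h l o <= 1.
    by apply: rest01 => l ->.
  have -> : \sum_o h i o = \sum_o w o * g o ^+ 2.
    by apply: eq_bigr => o _; rewrite /h eqxx.
  rewrite -[leLHS]add0r; apply: lerD; first exact: sqr_ge0.
  by rewrite ler_piMr// sumr_ge0// => o _; rewrite mulr_ge0// sqr_ge0.
rewrite (bigD1 j)//= mulrA addr0.
have /andP[r0 r1] : 0 <= \prod_(l | (l != i) && (l != j)) \sum_o h l o <= 1.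
  exact: rest01.
have -> : \sum_o h i o = \sum_o w o * g o.
  by apply: eq_bigr => o _; rewrite /h eqxx eq_sym (negPf ij) mulr1.
have -> : \sum_o h j o = \sum_o w o * g o.
  by apply: eq_bigr => o _; rewrite /h eqxx (negPf ij) mul1r.
by rewrite -expr2 ler_piMr// sqr_ge0.
Qed.

(** The square is expanded over pairs of coordinates. The mean of [g] is retained in the bound
    because truncation leaves a small drift. *)
Lemma second_moment_le :
  \sum_(f : {ffun 'I_n -> Om}) (\prod_i w (f i)) * (\sum_i g (f i)) ^+ 2 <=
  n%:R * (\sum_o w o * g o ^+ 2) + n%:R ^+ 2 * (\sum_o w o * g o) ^+ 2.
Proof.
under eq_bigr do rewrite expr2 big_distrlr mulr_sumr/=.
under eq_bigr do under eq_bigr do rewrite mulr_sumr/=.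
rewrite exchange_big/=; under eq_bigr do rewrite exchange_big/=.
apply: (@le_trans _ _ (\sum_(i < n) \sum_(j < n)
  ((\sum_o w o * g o) ^+ 2 + (if j == i then \sum_o w o * g o ^+ 2 else 0)))).
  by apply: ler_sum => i _; apply: ler_sum => j _; exact: pair_moment.
set e := \sum_o w o * g o; set v := \sum_o w o * g o ^+ 2.
rewrite (eq_bigr (fun=> n%:R * e ^+ 2 + v)) => [|i _].
  by rewrite sumr_const card_ord -[leLHS]mulr_natl mulrDr mulrA -expr2 addrC.
rewrite big_split/= sumr_const card_ord mulr_natl; congr (_ + _).
by rewrite -big_mkcond/= big_pred1_eq.
Qed.

Lemma chebyshev_weights (t : R) : 0 < t ->
  \sum_(f : {ffun 'I_n -> Om} | t <= (\sum_i g (f i)) ^+ 2) \prod_i w (f i) <=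
  (n%:R * (\sum_o w o * g o ^+ 2) + n%:R ^+ 2 * (\sum_o w o * g o) ^+ 2) / t.
Proof.
move=> t0; rewrite ler_pdivlMr// mulr_suml; apply: le_trans second_moment_le.
rewrite [leRHS](bigID (fun f : {ffun 'I_n -> Om} => t <= (\sum_i g (f i)) ^+ 2))/=.
rewrite -[leLHS]addr0; apply: lerD.
  by apply: ler_sum => f tf; rewrite ler_wpM2l// prodr_ge0.
by apply: sumr_ge0 => f _; rewrite mulr_ge0 ?prodr_ge0// sqr_ge0.
Qed.

End ProductWeights.

(** * Splitting fair bits off a distribution *)

Lemma coef_halfXD1n {R : realType} (K t : nat) :
  (((2^-1 : R) *: ('X + 1)) ^+ K)`_t = 'C(K, t)%:R / 2 ^+ K.
Proof.
rewrite exprZn coefZ exprVn mulrC; congr (_ / _).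
rewrite exprD1n (eq_bigr (fun i : 'I_K.+1 => 'C(K, i)%:R *: 'X^i)) => [|i _].
  by rewrite -(poly_def _ (fun i => 'C(K, i)%:R)) coef_poly; case: ltnP => // /bin_small ->.
by rewrite scaler_nat.
Qed.

Section BitDecomposition.
Context {R : realType}.
Variables (p : nat -> R) (q : R) (N : nat).
Hypothesis N1 : (1 < N)%N.

(* The weights [p] on [{0, ..., N - 1}] are split into a fair bit of weight [q],
   encoded by the index 0, and the residual weight of the value [j], encoded by
   the index [j.+1]. *)
Definition bit_weight (i : nat) : R :=
  if i is j.+1 then p j - (if (j < 2)%N then q / 2 else 0) else q.

(** At index 0 the function is averaged over the two outcomes of the bit. Values in a module cover
    both monomials and real statistics. *)
Definition bit_value {V : lmodType R} (h : nat -> V) (i : nat) : V :=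
  if i is j.+1 then h j else 2^-1 *: (h 0%N + h 1%N).

(** The bit gives back the [q / 2] removed from each of the values 0 and 1, both of which occur
    since [1 < N]. *)
Lemma sum_bit_weight (V : lmodType R) (h : nat -> V) :
  \sum_(i < N.+1) bit_weight i *: bit_value h i = \sum_(j < N) p j *: h j.
Proof.
case: N N1 => [//|[//|M]] _.
rewrite 3!big_ord_recl [in RHS]big_ord_recl big_ord_recl /=.
rewrite /bump/= !addrA; congr (_ + _); last first.
  by apply: eq_bigr => i _; rewrite subr0.
rewrite !scalerBl scalerA scalerDr -addrA [X in _ + X]addrACA -opprD addrC.
by rewrite subrK.
Qed.

Definition bits (i : nat) : nat := nat_of_bool (i == 0%N).

(** Expanding the power over the choice [f] of an index in each factor gives the polynomial
    [X^u ((X + 1)/2)^K]. The predecessor sends the bit, index 0, to shift 0, like the residual value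
    0 at index 1. *)
Lemma coef_bit_expansion (n k : nat) :
  ((\poly_(j < N) p j) ^+ n)`_k =
  \sum_(f : {ffun 'I_n -> 'I_N.+1}) (\prod_i bit_weight (f i)) *
    (let K := (\sum_i bits (f i))%N in let u := (\sum_i (f i).-1)%N in
     if (k < u)%N then 0 else 'C(K, k - u)%:R / 2 ^+ K).
Proof.
pose E (i : nat) : {poly R} := 'X^(i.-1) * ((2^-1 : R) *: ('X + 1)) ^+ (bits i).
have -> : \poly_(j < N) p j = \sum_(i < N.+1) bit_weight i *: E i.
  rewrite poly_def -(sum_bit_weight _ (fun j => 'X^j)); apply: eq_bigr => -[[|i] ?] _ //=.
    by rewrite /E /= mul1r expr1 expr0 addrC.
  by rewrite /E /= expr0 mulr1.
rewrite -[X in _ ^+ X]card_ord -prodr_const bigA_distr_bigA coef_sum.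
apply: eq_bigr => f _; rewrite scaler_prod coefZ big_split/= !prodrXr.
by rewrite coefXnM coef_halfXD1n.
Qed.

End BitDecomposition.

(** * Local limit bounds for a truncated distribution *)

Lemma bernoulli_ge {R : realFieldType} (x : R) (n : nat) :
  0 <= x <= 1 -> 1 - n%:R * x <= (1 - x) ^+ n.
Proof.
move=> /andP[x0 x1]; elim: n => [|n IH]; first by rewrite mul0r subr0 expr0.
have n0 : 0 <= n%:R :> R by rewrite ler0n.
rewrite exprS; have := ler_wpM2l (_ : 0 <= 1 - x) IH; rewrite subr_ge0 => /(_ x1).
apply: le_trans; rewrite -natr1; have : 0 <= n%:R * x * x by rewrite !mulr_ge0.
nra.
Qed.

Lemma bin_le_exp2 (K j : nat) : ('C(K, j) <= 2 ^ K)%N.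
Proof.
elim: K j => [|K IH] [|j] //; first by rewrite bin0 expn_gt0.
by rewrite binS expnS mul2n -addnn leq_add.
Qed.

Section LocalLimitCore.
Context {R : realType}.
Variables (p : nat -> R) (q mu V : R) (N n k : nat).
Hypotheses (p_ge0 : forall j, 0 <= p j) (q_gt0 : 0 < q) (q_le1 : q <= 1).
Hypotheses (p0q : q / 2 <= p 0%N) (p1q : q / 2 <= p 1%N).
Hypotheses (N1 : (1 < N)%N) (n_gt0 : (0 < n)%N) (V_ge0 : 0 <= V).
Variable nR : R.
Hypothesis nRE : nR = n%:R.
Hypothesis mass_le1 : \sum_(j < N) p j <= 1.
(** The truncation is so fine that [n] factors together keep mass at least 3/4, and that the mean of
    their sum moves by at most 1. *)
Hypothesis mass_ge : 1 - (4 * nR)^-1 <= \sum_(j < N) p j.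
Hypothesis drift : `|\sum_(j < N) p j * (j%:R - mu)| <= nR^-1.
Hypothesis variance : \sum_(j < N) p j * (j%:R - mu) ^+ 2 <= V.
Hypothesis kE : k%:R = mu * nR.

Local Notation Om := 'I_N.+1.
Local Notation w := (fun o : Om => bit_weight p q o).
Local Notation W f := (\prod_(i < n) bit_weight p q (fun_of_fin f i)).
Local Notation K f := (\sum_(i < n) bits (fun_of_fin f i))%N.
Local Notation u f := (\sum_(i < n) (fun_of_fin f i).-1)%N.
Definition local_coef : R := ((\poly_(j < N) p j) ^+ n)`_k.
Local Notation c := local_coef.

Lemma nR_gt0 : 0 < nR. Proof. by rewrite nRE ltr0n. Qed.
Lemma nR_ge1 : 1 <= nR. Proof. by rewrite nRE ler1n. Qed.

Lemma bit_weight_ge0 (o : Om) : 0 <= w o.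
Proof.
case: o => -[|[|[|j]]] ? /=; rewrite ?subr0 ?subr_ge0 ?p_ge0//.
exact: ltW.
Qed.

Lemma prod_weight_ge0 (f : {ffun 'I_n -> Om}) : 0 <= W f.
Proof. by apply: prodr_ge0 => i _; exact: bit_weight_ge0. Qed.

#[local] Hint Resolve nR_gt0 nR_ge1 bit_weight_ge0 prod_weight_ge0 : core.

Lemma sum_bit_weightR (h : nat -> R) :
  \sum_(o < N.+1) w o * bit_value (h : nat -> R^o) o = \sum_(j < N) p j * h j.
Proof. exact: (sum_bit_weight p q N N1 R^o h). Qed.

Lemma sum_bit_weight1 : \sum_(o < N.+1) w o = \sum_(j < N) p j.
Proof.
have := sum_bit_weightR (fun=> 1); under [in RHS]eq_bigr do rewrite mulr1; move=> <-.
apply: eq_bigr => -[[|j] jN] _; rewrite /bit_value /= ?mulr1//.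
by rewrite /GRing.scale/= (_ : 2^-1 * (1 + 1) = 1) ?mulr1//; lra.
Qed.

Lemma sum_bit_weight_le1 : \sum_(o < N.+1) w o <= 1. Proof. by rewrite sum_bit_weight1. Qed.

Lemma local_coefE : c = \sum_(f : {ffun 'I_n -> Om}) W f *
  (if (k < u f)%N then 0 else 'C(K f, k - u f)%:R / 2 ^+ K f).
Proof. exact: coef_bit_expansion. Qed.

Lemma sum_bits_le (f : {ffun 'I_n -> Om}) : (K f <= n)%N.
Proof.
apply: (@leq_trans (\sum_(i < n) 1)); last by rewrite sum1_card card_ord.
by apply: leq_sum => i _; rewrite /bits leq_b1.
Qed.

Lemma sum_prod_weight : \sum_(f : {ffun 'I_n -> Om}) W f = (\sum_(j < N) p j) ^+ n.
Proof. by rewrite -sum_bit_weight1; exact: (sum_prod_weights n w). Qed.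

Definition bits_dev (o : Om) : R := (bits o)%:R - q.

Lemma sum_bits_dev (f : {ffun 'I_n -> Om}) : \sum_i bits_dev (f i) = (K f)%:R - q * nR.
Proof.
by rewrite sumrB -natr_sum sumr_const card_ord nRE mulr_natr.
Qed.

(** One coordinate has second moment at most 1 and mean [q] times the missing mass, hence at most
    [1/n]. Chebyshev's numerator is thus at most [2n], against [(q n / 2)^2]. *)
Lemma few_bits :
  \sum_(f : {ffun 'I_n -> Om} | (q * nR / 2) ^+ 2 <= (\sum_i bits_dev (f i)) ^+ 2)
    W f <= 8 / (q ^+ 2 * nR).
Proof.
have t0 : 0 < (q * nR / 2) ^+ 2 by rewrite exprn_gt0// divr_gt0// mulr_gt0.
apply: (le_trans (chebyshev_weights n w bits_dev bit_weight_ge0 sum_bit_weight_le1 _ t0)).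
rewrite -nRE.
have v1 : \sum_(o < N.+1) w o * bits_dev o ^+ 2 <= 1.
  apply: le_trans sum_bit_weight_le1; apply: ler_sum => o _; rewrite ler_piMr//.
  have qq : q * q <= q by rewrite ler_piMr// ltW.
  by rewrite /bits_dev /bits; case: (_ == _); rewrite /=; nra.
have e1 : \sum_(o < N.+1) w o * bits_dev o = q * (1 - \sum_(j < N) p j).
  rewrite /bits_dev; under eq_bigr do rewrite mulrBr.
  rewrite sumrB -mulr_suml sum_bit_weight1 big_ord_recl /= big1 ?addr0.
    by rewrite (_ : bits 0 = 1%N)//; ring.
  by move=> i _; rewrite (_ : bits _ = 0%N)// mulr0.
have e2 : (\sum_(o < N.+1) w o * bits_dev o) ^+ 2 <= nR^-1 ^+ 2.
  have i0 : 0 < nR^-1 by rewrite invr_gt0.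
  rewrite e1 ler_sqr ?nnegrE; first last.
  - exact: ltW.
  - by rewrite mulr_ge0 ?subr_ge0// ltW.
  apply: (@le_trans _ _ (1 - \sum_(j < N) p j)).
    by rewrite ler_piMl// subr_ge0.
  by have := mass_ge; rewrite invfM; lra.
have e3 : nR ^+ 2 * (\sum_(o < N.+1) w o * bits_dev o) ^+ 2 <= nR.
  apply: le_trans nR_ge1; apply: (le_trans (ler_wpM2l _ e2)); first exact: sqr_ge0.
  by rewrite -exprMn mulfV ?expr1n// lt0r_neq0.
rewrite ler_pdivrMr//.
have -> : 8 / (q ^+ 2 * nR) * (q * nR / 2) ^+ 2 = 2 * nR.
  by field; rewrite !lt0r_neq0.
have : nR * \sum_(o < N.+1) w o * bits_dev o ^+ 2 <= nR by rewrite ler_piMr// ltW.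
by lra.
Qed.

Lemma many_bits (f : {ffun 'I_n -> Om}) :
  ~~ ((q * nR / 2) ^+ 2 <= (\sum_i bits_dev (f i)) ^+ 2) ->
  q * nR / 2 < (K f)%:R.
Proof.
rewrite sum_bits_dev -ltNge => H; rewrite ltNge; apply/negP => H2.
have : 0 < q * nR by rewrite mulr_gt0.
move: H H2; move: (q * nR) ((K f)%:R : R) => x y; nra.
Qed.

Lemma local_upper : c <= 14 / q ^+ 2 / Num.sqrt nR.
Proof.
have sn0 : 0 < Num.sqrt nR by rewrite sqrtr_gt0.
have sn1 : Num.sqrt nR <= nR.
  rewrite -{2}(sqr_sqrtr (ltW nR_gt0)) expr2 ler_peMr ?sqrtr_ge0//.
  by rewrite -[leLHS](@sqrtr1 R) ler_sqrt// ltW.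
have qn0 : 0 < q * nR / 2 by rewrite divr_gt0// mulr_gt0.
have q2 : 0 < q / 2 by rewrite divr_gt0.
(* This allows [q / 2] in place of its square root when [1 / sqrt K] is compared with
   [1 / sqrt n]. *)
have q2n : (q / 2) ^+ 2 * nR <= q * nR / 2.
  rewrite [leRHS]mulrAC expr2 ler_wpM2r ?(ltW nR_gt0)// ler_piMr ?(ltW q2)//.
  by move: q_le1; lra.
rewrite local_coefE (bigID (fun f : {ffun 'I_n -> Om} =>
  (q * nR / 2) ^+ 2 <= (\sum_i bits_dev (f i)) ^+ 2))/=.
(* The first term pays for the choices of [few_bits], with binomial weight at most 1; the second is
   [3 / sqrt K] with [K > q n / 2]. As [q <= 1], they add up to at most [14 / q^2]. *)
apply: (@le_trans _ _ (8 / q ^+ 2 / Num.sqrt nR + 6 / q / Num.sqrt nR)); last first.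
  rewrite -mulrDl ler_wpM2r ?invr_ge0 ?sqrtr_ge0//.
  rewrite (_ : 14 / q ^+ 2 = 8 / q ^+ 2 + 6 / q ^+ 2); last by field; rewrite lt0r_neq0.
  rewrite lerD2l ler_wpM2l// lef_pV2 ?posrE ?exprn_gt0// expr2 ler_piMr// ltW//.
apply: lerD.
  apply: (@le_trans _ _ (8 / (q ^+ 2 * nR))).
    apply: le_trans few_bits; apply: ler_sum => f _; rewrite ler_piMr//.
    case: ifP => // _; rewrite ler_pdivrMr ?exprn_gt0// mul1r -natrX ler_nat.
    exact: bin_le_exp2.
  by rewrite invfM mulrA ler_wpM2l ?divr_ge0 ?sqr_ge0// lef_pV2.
apply: (@le_trans _ _ (\sum_(f : {ffun 'I_n -> Om}) W f * (6 / q / Num.sqrt nR))); last first.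
  rewrite -mulr_suml sum_prod_weight; apply: ler_piMl.
    by rewrite !divr_ge0 ?sqrtr_ge0// ltW.
  by rewrite exprn_ile1// sumr_ge0.
rewrite [leRHS](bigID (fun f : {ffun 'I_n -> Om} =>
  (q * nR / 2) ^+ 2 <= (\sum_i bits_dev (f i)) ^+ 2))/=.
rewrite -[leLHS]add0r; apply: lerD.
  apply: sumr_ge0 => f _; rewrite mulr_ge0// !divr_ge0 ?sqrtr_ge0// ltW//.
apply: ler_sum => f /many_bits Kf; rewrite ler_wpM2l//.
case: ifP => _; first by rewrite !divr_ge0 ?sqrtr_ge0// ltW.
have K0 : (0 < K f)%N by rewrite -(ltr_nat R); lra.
apply: (le_trans (bin_half_le _ _ K0)).
rewrite (_ : 6 / q = 3 / (q / 2)); last by field; rewrite lt0r_neq0.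
rewrite -!mulrA ler_wpM2l// -invfM lef_pV2 ?posrE ?mulr_gt0 ?sqrtr_gt0 ?ltr0n ?invr_gt0//.
rewrite -(ger0_norm (ltW q2)) -sqrtr_sqr -sqrtrM ?sqr_ge0// ler_sqrt ?ler0n//.
exact: le_trans (ltW Kf).
Qed.

(** A bit counts with its mean 1/2, so the sum over the coordinates measures how far [k - u] lies
    from the centre [K / 2] of the binomial weight. *)
Definition value_dev (o : Om) : R := bit_value ((fun j => j%:R - mu) : nat -> R^o) o.

Lemma sum_value_dev (f : {ffun 'I_n -> Om}) :
  \sum_i value_dev (f i) = (u f)%:R + (K f)%:R / 2 - k%:R.
Proof.
rewrite kE !natr_sum mulr_suml -big_split/= -mulr_natr.
rewrite (_ : mu * nR = \sum_(i < n) mu); last by rewrite sumr_const card_ord nRE mulr_natr.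
rewrite -sumrB; apply: eq_bigr => i _; rewrite /value_dev /bit_value /bits.
by case: (f i) => -[|j] jN /=; rewrite /GRing.scale/=; lra.
Qed.

Lemma far_sum (A : R) : 0 < A ->
  \sum_(f : {ffun 'I_n -> Om} | A * nR <= (\sum_i value_dev (f i)) ^+ 2) W f <= (V + 1) / A.
Proof.
move=> A0; have t0 : 0 < A * nR by rewrite mulr_gt0.
apply: (le_trans (chebyshev_weights n w value_dev bit_weight_ge0 sum_bit_weight_le1 _ t0)).
rewrite -nRE.
rewrite sum_bit_weightR.
(* Averaging over the bit lowers the second moment, at index 0 by exactly 1/4. *)
have v1 : \sum_(o < N.+1) w o * value_dev o ^+ 2 <= V.
  apply: le_trans variance; rewrite -(sum_bit_weightR (fun j => (j%:R - mu) ^+ 2)).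
  apply: ler_sum => -[[|j] jN] _.
    rewrite ler_wpM2l//= /value_dev /= /GRing.scale/=; first exact: ltW.
    by rewrite -subr_ge0 [leRHS](_ : _ = 4^-1)//; field.
  by [].
have e1 : nR ^+ 2 * (\sum_(j < N) p j * (j%:R - mu)) ^+ 2 <= nR.
    apply: le_trans nR_ge1; rewrite -exprMn -real_normK ?num_real//.
  rewrite expr_le1// normrM (ger0_norm (ltW nR_gt0)).
  by rewrite -[leRHS](@mulfV _ nR) ?lt0r_neq0// ler_pM2l.
rewrite ler_pdivrMr// (_ : (V + 1) / A * (A * nR) = nR * V + nR); last first.
  by field; rewrite lt0r_neq0.
by apply: lerD => //; rewrite ler_wpM2l ?(ltW nR_gt0).
Qed.

Lemma local_lower : 128 * (V + 1) / q ^+ 2 <= nR ->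
  expR (- (3 / 2)) / 2 * expR (- (64 * (V + 1) / q)) / Num.sqrt nR <= c.
Proof.
move=> n_large.
have qn : 128 * (V + 1) <= q ^+ 2 * nR.
  by rewrite [leRHS]mulrC -ler_pdivrMr ?exprn_gt0.
(* This [A] makes the bound of [far_sum] equal to 1/8, and the lower bound on [n] is what gives
   [A n <= (q n / 4)^2]. *)
have [A AE] : exists A, A = 8 * (V + 1) by eexists.
have A0 : 0 < A by rewrite AE; move: V_ge0; lra.
pose bad1 (f : {ffun 'I_n -> Om}) := (q * nR / 2) ^+ 2 <= (\sum_i bits_dev (f i)) ^+ 2.
pose bad2 (f : {ffun 'I_n -> Om}) := A * nR <= (\sum_i value_dev (f i)) ^+ 2.
pose b : R := expR (- (3 / 2)) / Num.sqrt nR * expR (- (64 * (V + 1) / q)).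
have b0 : 0 <= b by rewrite /b mulr_ge0 ?divr_ge0 ?expR_ge0 ?sqrtr_ge0.
have good f : ~~ bad1 f -> ~~ bad2 f ->
    b <= (if (k < u f)%N then 0 else 'C(K f, k - u f)%:R / 2 ^+ K f).
  move=> /many_bits Kf; rewrite /bad2 sum_value_dev -ltNge => dev.
  move: (K f : nat) (u f : nat) Kf dev (sum_bits_le f) => Kf uf Kbig dev Kn.
  have K0 : 0 < Kf%:R :> R by apply: lt_trans Kbig; rewrite divr_gt0// mulr_gt0.
  have An : A * nR <= (q * nR / 4) ^+ 2.
    rewrite (_ : (q * nR / 4) ^+ 2 = q ^+ 2 * nR / 16 * nR); last by field.
    by rewrite ler_wpM2r ?(ltW nR_gt0)// ler_pdivlMr//; move: qn; rewrite AE; lra.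
  (* A deviation below [K / 2] puts [k - u] strictly between 0 and [K]: the default value 0 is
     excluded and [bin_half_ge] applies. *)
  have : `|uf%:R + Kf%:R / 2 - k%:R| < Kf%:R / 2 :> R.
    rewrite -(@ltr_pXn2r _ 2)// ?nnegrE ?divr_ge0 ?ler0n// real_normK ?num_real//.
    apply: lt_le_trans dev _; apply: le_trans An _.
    rewrite ler_sqr ?nnegrE ?divr_ge0 ?ler0n ?mulr_ge0 ?(ltW q_gt0) ?(ltW nR_gt0)//.
    by move: Kbig; lra.
  rewrite ltr_norml => /andP[lo hi].
  have uk : (uf < k)%N by rewrite -(ltr_nat R); lra.
  have ku : (k < uf + Kf)%N by rewrite -(ltr_nat R) natrD; lra.
  rewrite ltnNge (ltnW uk)/=; have tK : (0 < k - uf < Kf)%N.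
    by rewrite subn_gt0 uk ltn_subLR// ltnW.
  apply: le_trans (bin_half_ge _ _ tK); rewrite /b.
  apply: ler_pM; rewrite ?divr_ge0 ?expR_ge0 ?sqrtr_ge0//.
    rewrite ler_wpM2l ?expR_ge0// lef_pV2 ?posrE ?sqrtr_gt0//.
    by rewrite ler_sqrt ?(ltW nR_gt0)// nRE ler_nat.
  rewrite ler_expR lerN2 ler_pdivrMr// natrB 1?ltnW//.
  rewrite (_ : (2 * (k%:R - uf%:R) - Kf%:R) ^+ 2 =
    4 * (uf%:R + Kf%:R / 2 - k%:R) ^+ 2); last by field.
  (* The exponent is four times the squared deviation, at most [32 (V + 1) n], over
     [K > q n / 2]. *)
  apply: (@le_trans _ _ (64 * (V + 1) / q * (q * nR / 2))); last first.
    apply: ler_wpM2l (ltW Kbig); rewrite divr_ge0 ?(ltW q_gt0)//.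
    by move: V_ge0; lra.
  rewrite (_ : 64 * (V + 1) / q * (q * nR / 2) = 4 * (A * nR)).
    by rewrite ler_wpM2l// ltW.
  by rewrite AE; field; rewrite lt0r_neq0.
(* Bernoulli's inequality gives total mass at least 3/4, and each of the two bad sets takes at most
   1/8. *)
have W_good : 2^-1 <= \sum_(f | ~~ bad1 f && ~~ bad2 f) W f.
  have tot : 3 / 4 <= \sum_(f : {ffun 'I_n -> Om}) W f.
    rewrite sum_prod_weight.
    have x01 : 0 <= (4 * nR)^-1 <= 1.
      rewrite invr_ge0 mulr_ge0 ?(ltW nR_gt0)//= invf_le1 ?mulr_gt0//.
      by move: nR_ge1; lra.
    have := bernoulli_ge _ n x01; rewrite -nRE.
    rewrite (_ : nR * (4 * nR)^-1 = 4^-1); last by field; rewrite lt0r_neq0.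
    move=> /(le_trans _) H; apply: (@le_trans _ _ ((1 - (4 * nR)^-1) ^+ n)).
      by apply: H; lra.
    apply: lerXn2r mass_ge; rewrite nnegrE ?subr_ge0; first by case/andP: x01.
    exact: sumr_ge0.
  have B1 : \sum_(f | bad1 f) W f <= 8^-1.
    apply: (le_trans few_bits).
    rewrite ler_pdivrMr ?mulr_gt0 ?exprn_gt0//; move: qn V_ge0; lra.
  have B2 : \sum_(f | bad2 f) W f <= 8^-1.
    apply: (le_trans (far_sum _ A0)).
    by rewrite ler_pdivrMr// AE; lra.
  have B2' : \sum_(f | ~~ bad1 f && bad2 f) W f <= 8^-1.
    apply: le_trans B2; rewrite [leRHS](bigID bad1)/= addrC.
    by under eq_bigl do rewrite andbC; rewrite lerDl sumr_ge0.
  rewrite (bigID bad1)/= [X in _ <= _ + X](bigID bad2)/= in tot.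
  by move: tot B1 B2'; lra.
rewrite local_coefE (bigID (fun f : {ffun 'I_n -> Om} => ~~ bad1 f && ~~ bad2 f))/=.
apply: (@le_trans _ _ (\sum_(f | ~~ bad1 f && ~~ bad2 f) W f * b)).
  rewrite -mulr_suml; apply: le_trans (ler_wpM2r b0 W_good).
  by rewrite /b le_eqVlt; apply/orP; left; apply/eqP; ring.
rewrite -[leLHS]addr0; apply: lerD.
  by apply: ler_sum => f /andP[f1 f2]; rewrite ler_wpM2l// good.
apply: sumr_ge0 => f _; rewrite mulr_ge0//; by case: ifP.
Qed.

End LocalLimitCore.

(** * Counting throws by generating functions *)

Lemma deriv_prod {R : comNzRingType} (n : nat) (G : 'I_n -> {poly R}) :
  (\prod_i G i)^`() = \sum_(i0 < n) \prod_i (G i)^`(i0 == i).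
Proof.
elim: n G => [|n IH] G; first by rewrite !big_ord0 derivC.
rewrite big_ord_recl derivM IH big_ord_recl; congr (_ + _).
  by rewrite big_ord_recl; congr (_ * _); apply: eq_bigr.
rewrite mulr_sumr; apply: eq_bigr => i0 _; rewrite big_ord_recl.
by congr (_ * _); apply: eq_bigr => i _; rewrite (inj_eq lift_inj).
Qed.

Lemma big_ffun_recl {R : nmodType} {T : finType} (m : nat)
    (F : T -> {ffun 'I_m -> T} -> R) :
  \sum_(t : T) \sum_(f : {ffun 'I_m -> T}) F t f =
  \sum_(g : {ffun 'I_m.+1 -> T}) F (g ord0) [ffun j => g (lift ord0 j)].
Proof.
rewrite pair_bigA/=.
pose split_head (g : {ffun 'I_m.+1 -> T}) := (g ord0, [ffun j => g (lift ord0 j)]).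
pose cons_head (x : T * {ffun 'I_m -> T}) : {ffun 'I_m.+1 -> T} :=
  [ffun j => if unlift ord0 j is Some j' then x.2 j' else x.1].
have bij : bijective split_head.
  exists cons_head => [g|[t f]].
    by apply/ffunP => j; rewrite ffunE/=; case: unliftP => [j' ->|->]//; rewrite ffunE.
  rewrite /split_head /cons_head ffunE unlift_none/=; congr (_, _).
  by apply/ffunP => j; rewrite !ffunE liftK.
by rewrite (reindex split_head)//; exact: onW_bij.
Qed.

(** Each of the [m] derivations selects one of the [n] factors, which is a throw of [m] balls into
    [n] bins; a factor is differentiated as often as its load says. *)
Lemma derivn_prod {R : comNzRingType} (n m : nat) (H : 'I_n -> {poly R}) :
  (\prod_i H i)^`(m) =
  \sum_(f : {ffun 'I_m -> 'I_n}) \prod_i (H i)^`(#|[pred j | f j == i]|).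
Proof.
elim: m => [|m IH].
  transitivity (\sum_(f : {ffun 'I_0 -> 'I_n}) \prod_i H i).
    by rewrite sumr_const card_ffun !card_ord expn0.
  apply: eq_bigr => f _; apply: eq_bigr => i _.
  by rewrite (_ : #|_| = 0%N)//; apply: eq_card0 => -[].
rewrite derivnS IH raddf_sum/=.
under eq_bigr do rewrite deriv_prod.
rewrite exchange_big big_ffun_recl; apply: eq_bigr => g _; apply: eq_bigr => i _.
have -> : #|[pred j | g j == i]| =
    ((g ord0 == i) + #|[pred j | [ffun j => g (lift ord0 j)] j == i]|)%N.
  rewrite -!sum1_card !(big_mkcond (fun j => j \in _))/= big_ord_recl/=.
  congr (_ + _)%N.
  by apply: eq_bigr => j _; rewrite !inE ffunE.
by case: eqP => _ /=; rewrite ?derivn0 ?derivn1 ?add0n// add1n derivnS.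
Qed.

(** The exponential series without its first [d] terms, divided by [X^d] and cut off to be a
    polynomial. *)
Definition fact_series {R : realType} (d N : nat) : {poly R} :=
  \poly_(j < N) (j + d)`!%:R^-1.

Lemma card_all_loads_ge {R : realType} (n d k m N : nat) :
  m = (d * n + k)%N -> (m < N)%N ->
  #|[pred f : {ffun 'I_m -> 'I_n} | [forall i, (d <= #|[pred j | f j == i]|)%N]]|%:R
    = m`!%:R * (fact_series d N ^+ n)`_k :> R.
Proof.
move=> mE mN; pose H : {poly R} := 'X^d * fact_series d N.
(* The derivatives of [H] at 0 indicate the loads that are at least [d], so the
   Leibniz rule for [H ^+ n] at 0 counts the throws. *)
have Hk (l : nat) : (l <= m)%N -> H^`(l).[0] = (d <= l)%N%:R.
  move=> lm; rewrite horner_coef0 coef_derivn addn0 ffactnn coefXnM ltnNge.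
  case: leqP => /= dl; last by rewrite mul0rn.
  rewrite coef_poly (leq_ltn_trans (leq_subr _ _) (leq_ltn_trans lm mN)) subnK//.
  by rewrite -[LHS]mulr_natr mulVf// pnatr_eq0 -lt0n fact_gt0.
have : (\prod_(i < n) H)^`(m).[0] = m`!%:R * (fact_series d N ^+ n)`_k.
  rewrite horner_coef0 coef_derivn addn0 ffactnn prodr_const card_ord exprMn.
  by rewrite -exprM coefXnM {1 2}mE ltnNge leq_addr/= addKn mulr_natl.
move=> <-; rewrite derivn_prod horner_sum -sum1_card natr_sum big_mkcond/=.
apply: eq_bigr => f _; rewrite horner_prod.
rewrite (eq_bigr (fun i => (d <= #|[pred j | f j == i]|)%N%:R)) => [|i _]; last first.
  by rewrite Hk// (leq_trans (max_card _))// card_ord.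
rewrite inE; case: ifPn => [/forallP dl|/forallPn[i dl]].
  by rewrite big1// => i _; rewrite dl.
by rewrite (bigD1 i)//= (negPf dl) mul0r.
Qed.

(** The event is the disjoint union, over the good throws [f], of the events that the balls follow
    [f]; independence of all balls gives each of them probability [n^-m]. *)
Lemma probability_all_loads_ge {R : realType} {disp : measure_display}
    {T : measurableType disp} (P : probability T R) (n m d : nat)
    (ball : 'I_m -> T -> 'I_n) : random_throw P ball ->
  P (all_loads_ge d ball) =
  (#|[pred f : {ffun 'I_m -> 'I_n} | [forall i, (d <= #|[pred j | f j == i]|)%N]]|%:R
    / n%:R ^+ m)%:E.
Proof.
move=> [meas unif indep].
pose B (f : {ffun 'I_m -> 'I_n}) : set T :=
  \bigcap_(j in [set` [set: 'I_m]%SET]) (ball j @^-1` [set f j]).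
have PB f : P (B f) = (n%:R^-1 ^+ m)%:E.
  rewrite (indep [set: 'I_m]%SET (fun j => [set f j])).
  rewrite (eq_bigr (fun=> (n%:R^-1)%:E)) => [|j _]; last exact: unif.
  by rewrite prodEFin prodr_const cardsT card_ord.
have mB f : measurable (B f).
  apply: fin_bigcap_measurable => //.
  by move=> j _; exact: meas.
have BE w f : B f w <-> f = [ffun j => ball j w].
  split=> [Bf|-> j _ /=]; last by rewrite ffunE.
  by apply/ffunP => j; rewrite ffunE -(Bf j)//= inE.
pose good := [pred f : {ffun 'I_m -> 'I_n} | [forall i, (d <= #|[pred j | f j == i]|)%N]].
have loadE w i : #|[pred j | [ffun j => ball j w] j == i]| = load ball i w.
  by apply: eq_card => j; rewrite !inE ffunE.
have -> : all_loads_ge d ball = \bigcup_(f in [set` enum good]) B f.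
  apply/seteqP; split=> [w dl|w [f /=]].
    exists [ffun j => ball j w]; last exact/BE.
    by rewrite /= mem_enum inE; apply/forallP => i; rewrite loadE; exact: dl.
  by rewrite mem_enum inE => /forallP fd /BE fE i; rewrite -loadE -fE; exact: fd.
rewrite measure_fin_bigcup//; last first.
  by move=> f g _ _ [w [/BE -> /BE ->]].
rewrite -fsbig_seq ?enum_uniq//; rewrite (eq_bigr _ (fun f _ => PB f)).
by rewrite big_enum sumEFin sumr_const; congr (_%:E); rewrite -[LHS]mulr_natl exprVn.
Qed.

(** * Local limit bounds for an infinite distribution *)

(** The cut-off [N] is chosen after [n], far enough out for the mass and drift conditions at that
    [n]. The bound [M] lets the cut-off also exceed the number of balls. *)
Lemma local_limit {R : realType} (p : nat -> R) (mu V : R) :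
  (forall j, 0 <= p j) -> 0 < p 0%N -> 0 < p 1%N ->
  (\sum_(j < N) p j @[N --> \oo] --> (1 : R)) ->
  (\sum_(j < N) p j * j%:R @[N --> \oo] --> mu) ->
  (forall N, \sum_(j < N) p j * (j%:R - mu) ^+ 2 <= V) ->
  exists c C : R, 0 < c /\ 0 < C /\
    exists n0 : nat, forall n k M : nat, (n0 <= n)%N -> (0 < n)%N ->
      k%:R = mu * n%:R ->
      exists2 N, (M <= N)%N &
        c / Num.sqrt n%:R <= ((\poly_(j < N) p j) ^+ n)`_k <= C / Num.sqrt n%:R.
Proof.
move=> p_ge0 p0 p1 mass mean var.
(* The largest bit weight up to 1 whose halves fit under both [p 0] and [p 1]. *)
pose q0 : R := Num.min 1 (Num.min (2 * p 0%N) (2 * p 1%N)).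
have [q [qE q_gt0 q_le1 p0q p1q]] : exists q : R, [/\ q = q0, 0 < q, q <= 1,
    q / 2 <= p 0%N & q / 2 <= p 1%N].
  exists q0; split => //; rewrite /q0.
  - by rewrite !lt_min ltr01 !mulr_gt0.
  - by rewrite ge_min lexx.
  - by rewrite ler_pdivrMr// [leRHS]mulrC !ge_min lexx orbT.
  - by rewrite ler_pdivrMr// [leRHS]mulrC !ge_min lexx !orbT.
have V_ge0 : 0 <= V by apply: le_trans (var 0%N); rewrite big_ord0.
exists (expR (- (3 / 2)) / 2 * expR (- (64 * (V + 1) / q))), (14 / q ^+ 2).
split; first by rewrite mulr_gt0 ?divr_gt0 ?expR_gt0.
split; first by rewrite divr_gt0 ?exprn_gt0.
have [n0 n0V] : exists n0 : nat, 128 * (V + 1) / q ^+ 2 <= n0%:R.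
  exists (Num.trunc (128 * (V + 1) / q ^+ 2)).+1.
  exact/ltW/truncnS_gt.
exists n0 => n k M n0n n_gt0 kE.
have nR0 : 0 < n%:R :> R by rewrite ltr0n.
have mass_near : \forall N \near \oo, 1 - (4 * n%:R)^-1 <= \sum_(j < N) p j.
  apply: (cvgr_ge _ mass); rewrite gtrBl invr_gt0; lra.
have drift_near : \forall N \near \oo,
    `|\sum_(j < N) p j * (j%:R - mu)| <= n%:R^-1.
  have drift0 : \sum_(j < N) p j * (j%:R - mu) @[N --> \oo] --> (0 : R).
    rewrite (_ : (fun N => _) = (fun N => \sum_(j < N) p j * j%:R -
        mu * \sum_(j < N) p j)); last first.
      apply/funext => N; rewrite mulr_sumr -sumrB.
      by apply: eq_bigr => j _; ring.
    have : \sum_(j < N) p j * j%:R - mu * \sum_(j < N) p j @[N --> \oo] -->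
        mu - mu * 1.
      by apply: cvgB => //; apply: cvgM => //; exact: cvg_cst.
    by rewrite mulr1 subrr.
  have := @cvgr_distC_le _ _ _ _ _ _ _ drift0 n%:R^-1.
  rewrite invr_gt0 => /(_ _ nR0) H; apply: filterS H => N.
  by rewrite subr0.
have [N [MN N1 massN driftN]] : exists N, [/\ (M <= N)%N, (1 < N)%N,
    1 - (4 * n%:R)^-1 <= \sum_(j < N) p j &
    `|\sum_(j < N) p j * (j%:R - mu)| <= n%:R^-1].
  near \oo => N; exists N; split.
  - by near: N; exact: nbhs_infty_ge.
  - by near: N; exact: nbhs_infty_gt.
  - by near: N; exact: mass_near.
  - by near: N; exact: drift_near.
have mass_le1 : \sum_(j < N) p j <= 1.
  rewrite -(cvg_lim (@Rhausdorff R) mass).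
  apply: (@nondecreasing_cvgn_le _ (fun N => \sum_(j < N) p j)); last first.
    by apply/cvg_ex; exists 1.
  apply/nondecreasing_seqP => i; rewrite big_ord_recr/= lerDl.
  exact: p_ge0.
have large : 128 * (V + 1) / q ^+ 2 <= n%:R by apply: le_trans n0V _; rewrite ler_nat.
exists N => //; apply/andP; split.
  exact: (@local_lower R p q mu V N n k).
exact: (local_upper p q N n k).
Unshelve. all: end_near.
Qed.

(** * Normalisation, mean and parameter of the truncated Poisson distribution *)

Section Zeta.
Context {R : realType}.
Implicit Types (d : nat) (l : R).

(** After the index shift by [d] the partial sums increase and stay below those of the exponential
    series. *)
Lemma zeta_cvg d l : 0 <= l ->
  \sum_(j < N) l ^+ j / (j + d)`!%:R @[N --> \oo] --> tpoisson_zeta d l.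
Proof.
move=> l0; pose s N : R := \sum_(j < N) l ^+ j / (j + d)`!%:R.
have term_ge0 j e : 0 <= l ^+ j / (j + e)`!%:R :> R.
  by rewrite divr_ge0 ?exprn_ge0.
have cs : cvgn s.
  apply: nondecreasing_is_cvgn.
    by apply/nondecreasing_seqP => N; rewrite /s big_ord_recr/= lerDl.
  exists (expR l) => _ [N _ <-].
  apply: (@le_trans _ _ (series (exp_coeff l) N)).
    rewrite /series/= big_mkord; apply: ler_sum => j _.
    rewrite /exp_coeff/= ler_wpM2l ?exprn_ge0// lef_pV2 ?posrE ?ltr0n ?fact_gt0//.
    by rewrite ler_nat leq_fact// leq_addr.
  apply: nondecreasing_cvgn_le; last exact: is_cvg_series_exp_coeff.
  apply/nondecreasing_seqP => M; rewrite /series/= big_nat_recr//= lerDl.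
  by rewrite /exp_coeff/= -[M in M`!]addn0.
suff -> : tpoisson_zeta d l = limn s by exact: cs.
rewrite /tpoisson_zeta.
apply: cvg_lim; first exact: Rhausdorff.
rewrite -(cvg_shiftn d) (_ : (fun N => _) = s); first exact: cs.
apply/funext => N; rewrite /s -{1}[d]add0n big_addn addnK big_mkord.
by apply: eq_bigr => j _; rewrite addnK.
Qed.

Lemma zeta_partial_le d N l : 0 <= l ->
  \sum_(j < N) l ^+ j / (j + d)`!%:R <= tpoisson_zeta d l.
Proof.
move=> l0; have c := zeta_cvg d l l0; rewrite -(cvg_lim (@Rhausdorff R) c).
apply: (@nondecreasing_cvgn_le _ (fun N => \sum_(j < N) l ^+ j / (j + d)`!%:R)).
  apply/nondecreasing_seqP => M; rewrite big_ord_recr/= lerDl.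
  by rewrite divr_ge0 ?exprn_ge0.
by apply/cvg_ex; exists (tpoisson_zeta d l).
Qed.

Lemma zeta_ge d l : 0 <= l -> d`!%:R^-1 <= tpoisson_zeta d l.
Proof.
by move=> /(zeta_partial_le d 1); rewrite big_ord1 expr0 mul1r add0n.
Qed.

Lemma zeta_gt0 d l : 0 <= l -> 0 < tpoisson_zeta d l.
Proof. by move=> /(zeta_ge d); apply: lt_le_trans; rewrite invr_gt0 ltr0n fact_gt0. Qed.

Lemma zeta_rec d l : 0 <= l ->
  tpoisson_zeta d l = d`!%:R^-1 + l * tpoisson_zeta d.+1 l.
Proof.
move=> l0; have c := zeta_cvg d l l0.
have c' : \sum_(j < N) l ^+ j / (j + d)`!%:R @[N --> \oo] -->
    d`!%:R^-1 + l * tpoisson_zeta d.+1 l.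
  rewrite -cvg_shiftS (_ : (fun N => _) =
      fun N => d`!%:R^-1 + l * \sum_(j < N) l ^+ j / (j + d.+1)`!%:R); last first.
    apply/funext => N; rewrite big_ord_recl expr0 mul1r add0n mulr_sumr.
    by congr (_ + _); apply: eq_bigr => j _; rewrite addnS exprS mulrA.
  apply: cvgD; first exact: cvg_cst.
  by apply: cvgM; [exact: cvg_cst|exact: zeta_cvg].
rewrite -(cvg_lim (@Rhausdorff R) c).
by apply: (cvg_lim (@Rhausdorff R)); exact: c'.
Qed.

Lemma zeta0 l : 0 <= l -> tpoisson_zeta 0 l = expR l.
Proof.
move=> l0; have := zeta_cvg 0 l l0 => /(cvg_lim (@Rhausdorff R)) <-.
rewrite /expR; congr (limn _); apply/funext => N.
by rewrite /series/= big_mkord; apply: eq_bigr => j _; rewrite addn0.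
Qed.

(** Since [i / i! = 1 / (i - 1)!], the mean is the quotient of the zetas for [d] and [d.+1], and
    [zeta_rec] brings it to this form. *)
Lemma tpoisson_mean_cvg d l : 0 <= l ->
  \sum_(j < N) (j + d.+1)%:R * ((tpoisson_zeta d.+1 l)^-1 *
      (l ^+ j / (j + d.+1)`!%:R)) @[N --> \oo] -->
    l + (d`!%:R * tpoisson_zeta d.+1 l)^-1.
Proof.
move=> l0; have z0 := zeta_gt0 d.+1 l l0.
have f0 : d`!%:R != 0 :> R by rewrite pnatr_eq0 -lt0n fact_gt0.
rewrite (_ : l + _ = (tpoisson_zeta d.+1 l)^-1 * tpoisson_zeta d l); last first.
  rewrite (zeta_rec d)//; move: (tpoisson_zeta _ _) (d`!%:R) z0 f0 => z x z0 x0.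
  by field; rewrite x0 lt0r_neq0.
rewrite (_ : (fun N => _) = fun N =>
    (tpoisson_zeta d.+1 l)^-1 * \sum_(j < N) l ^+ j / (j + d)`!%:R); last first.
  apply/funext => N; rewrite mulr_sumr; apply: eq_bigr => j _.
  rewrite addnS factS natrM.
  move: (l ^+ j) => x; field.
  by rewrite (lt0r_neq0 z0) -natrD nat1r !pnatr_eq0 -lt0n fact_gt0.
by apply: cvgM; [exact: cvg_cst|exact: zeta_cvg].
Qed.

Lemma tpoisson_meanE d l : 0 <= l ->
  tpoisson_mean d.+1 l = (l + (d`!%:R * tpoisson_zeta d.+1 l)^-1)%:E.
Proof.
move=> l0; rewrite /tpoisson_mean; apply: cvg_lim => //.
rewrite -(cvg_shiftn d.+1) (_ : (fun N => _) = EFin \o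
    (fun N => \sum_(j < N) (j + d.+1)%:R * ((tpoisson_zeta d.+1 l)^-1 *
      (l ^+ j / (j + d.+1)`!%:R)))); last first.
  apply/funext => N /=; rewrite sumEFin big_mkord addnC big_split_ord/=.
  rewrite big1 ?add0r => [|j _]; last by rewrite /tpoisson_pmf ltn_ord mulr0.
  congr (_%:E); apply: eq_bigr => j _.
  by rewrite /tpoisson_pmf ltnNge leq_addr/= addKn addnC.
by apply: cvg_EFin; [exact: nearW|exact: tpoisson_mean_cvg].
Qed.

(* For [l > 0] this equals [zeta], and it is visibly continuous in [l]. *)
Fixpoint zeta_closed d l : R :=
  if d is e.+1 then (zeta_closed e l - e`!%:R^-1) / l else expR l.

Lemma zeta_closedE d l : 0 < l -> zeta_closed d l = tpoisson_zeta d l.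
Proof.
move=> l0; elim: d => [|d IH] /=; first by rewrite zeta0 ?ltW.
by rewrite IH zeta_rec ?ltW// addrC addKr mulrAC mulfV ?mul1r// lt0r_neq0.
Qed.

Lemma zeta_closed_continuous d l : 0 < l -> {for l, continuous (zeta_closed d)}.
Proof.
move=> l0; elim: d => [|d IH] /=; first exact: continuous_expR.
apply: cvgM; last by apply: cvgV; [rewrite lt0r_neq0|exact: cvg_id].
by apply: cvgB; [exact: IH|exact: cvg_cst].
Qed.

(* As [zeta >= 1 / d.+1`!], the mean lies between [l] and [l + d.+1]: the
   intermediate value theorem applies on [[alpha - d.+1, alpha]]. *)
Lemma tpoisson_lambdaP d (alpha : R) : d.+1%:R < alpha ->
  0 < tpoisson_lambda alpha d.+1 /\
  tpoisson_mean d.+1 (tpoisson_lambda alpha d.+1) = alpha%:E.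
Proof.
move=> da; have f0 e : 0 < e`!%:R :> R by rewrite ltr0n fact_gt0.
have ratio : d`!%:R * (d.+1)`!%:R^-1 = d.+1%:R^-1 :> R.
  by rewrite factS natrM invfM mulrCA mulfV ?mulr1// lt0r_neq0.
pose F l : R := l + (d`!%:R * zeta_closed d.+1 l)^-1.
have FE l : 0 < l -> tpoisson_mean d.+1 l = (F l)%:E.
  by move=> l0; rewrite tpoisson_meanE ?ltW// /F zeta_closedE.
have e0 : 0 < alpha - d.+1%:R by rewrite subr_gt0.
have ea : alpha - d.+1%:R <= alpha by rewrite gerBl.
have a0 : 0 < alpha by apply: lt_le_trans ea.
have contF : {within `[alpha - d.+1%:R, alpha], continuous F}.
  apply: continuous_in_subspaceT => l; rewrite inE/= in_itv/= => /andP[el _].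
  have l0 : 0 < l by apply: lt_le_trans el.
  apply: cvgD; first exact: cvg_id.
  apply: cvgV; first by rewrite zeta_closedE// mulf_neq0 ?lt0r_neq0// zeta_gt0 ?ltW.
  by apply: cvgM; [exact: cvg_cst|exact: zeta_closed_continuous].
have Flo : F (alpha - d.+1%:R) <= alpha.
  rewrite /F zeta_closedE// -lerBrDl subKr.
  have := zeta_ge d.+1 _ (ltW e0); set z := tpoisson_zeta _ _ => zge.
  have z0 : 0 < z by apply: lt_le_trans zge; rewrite invr_gt0.
  rewrite -[leRHS]invrK lef_pV2 ?posrE ?mulr_gt0 ?invr_gt0//.
  apply: le_trans (ler_wpM2l (ltW (f0 d)) zge).
  by rewrite ratio.
have Fhi : alpha <= F alpha.
  rewrite /F zeta_closedE// lerDl invr_ge0 mulr_ge0//.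
  by rewrite ltW// zeta_gt0// ltW.
have [|l lin Fl] := @IVT _ F _ _ alpha ea contF.
  by rewrite ge_min le_max Flo Fhi orbT.
have l0 : 0 < l by move: lin; rewrite in_itv/= => /andP[+ _]; apply: lt_le_trans.
have [L0 LE] : 0 <= tpoisson_lambda alpha d.+1 /\
    tpoisson_mean d.+1 (tpoisson_lambda alpha d.+1) = alpha%:E.
  rewrite /tpoisson_lambda.
  apply: (@xgetPex _ 0 [set l | 0 <= l /\ tpoisson_mean d.+1 l = alpha%:E]).
  by exists l; split; [exact: ltW|rewrite FE// Fl].
(* The chosen parameter is so far only nonnegative; at 0 the mean would be [d.+1], which is less
   than [alpha]. *)
split=> //; rewrite lt0r L0 andbT; apply/eqP => L; move: LE.
rewrite L tpoisson_meanE// zeta_rec// mul0r addr0 add0r => -[].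
rewrite ratio invrK => ad.
by move: da; rewrite -ad ltxx.
Qed.

End Zeta.

(** * Tilting and the two regimes *)

Lemma coef_compXscale {R : comNzRingType} (p : {poly R}) (c : R) (i : nat) :
  (p \Po (c *: 'X))`_i = p`_i * c ^+ i.
Proof.
rewrite coef_comp_poly (eq_bigr (fun j : 'I_(size p) =>
    if j == i :> nat then p`_i * c ^+ i else 0)) => [|j _]; last first.
  by rewrite exprZn coefZ coefXn eq_sym; case: eqP => [->|_]; rewrite ?mulr1 ?mulr0.
rewrite -big_mkcond/=; case: (ltnP i (size p)) => [ip|pi].
  by rewrite (big_pred1 (Ordinal ip)).
by rewrite nth_default// mul0r big1.
Qed.

(** This is the exponential tilt: replacing [X] by [l X] and scaling by [a] changes a coefficient of
    the power only by the explicit factor [a^n l^k]. *)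
Lemma coef_fact_series_scaled {R : realType} (a l : R) (d N n k : nat) :
  ((\poly_(j < N) (a * (l ^+ j / (j + d)`!%:R))) ^+ n)`_k =
  a ^+ n * l ^+ k * (fact_series d N ^+ n)`_k.
Proof.
have -> : \poly_(j < N) (a * (l ^+ j / (j + d)`!%:R)) =
    a *: (fact_series d N \Po (l *: 'X)).
  apply/polyP => i; rewrite coefZ coef_compXscale !coef_poly.
  by case: ifP => _; [ring|rewrite mul0r mulr0].
by rewrite exprZn coefZ -rmorphXn/= coef_compXscale -mulrA [_ * l ^+ k]mulrC.
Qed.

(** As [m = a n], division by [n^m] turns the [m^m] of Stirling's formula into [a^m]. *)
Lemma scaled_stirling {R : realType} (m n : nat) (a : R) : (0 < m)%N -> (0 < n)%N ->
  m%:R = a * n%:R ->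
  let s := Num.sqrt m%:R * (a ^+ m / expR m%:R) in
  expR 2^-1 * s <= m`!%:R / n%:R ^+ m <= expR 1 * s.
Proof.
move=> m0 n0 mE /=; have [lo hi] := @stirling R m m0.
have nm : 0 < n%:R ^+ m :> R by rewrite exprn_gt0// ltr0n.
rewrite ler_pdivlMr// ler_pdivrMr//.
have mm : m%:R ^+ m = a ^+ m * n%:R ^+ m :> R by rewrite -exprMn -mE.
have cancel (c s t u v : R) : c * (s * (t * v / u)) = c * (s * (t / u)) * v by ring.
by move: lo hi; rewrite mm !cancel => -> ->.
Qed.

Lemma all_loads_ge_supercritical {R : realType} (d : nat) (alpha : R) :
    d.+1%:R < alpha ->
    let lambda := tpoisson_lambda alpha d.+1 in
    let zeta := tpoisson_zeta d.+1 lambda in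
    let b := (alpha `^ alpha * zeta) / (expR alpha * lambda `^ (alpha - d.+1%:R)) in
    exists c C : R, 0 < c /\ c <= C /\
      exists N : nat, forall n m : nat,
        (0 < n)%N -> (N <= n)%N -> m%:R = alpha * n%:R ->
        forall (disp : measure_display) (T : measurableType disp)
          (P : probability T R) (ball : 'I_m -> T -> 'I_n),
          random_throw P ball ->
          ((c * b ^+ n)%:E <= P (all_loads_ge d.+1 ball))%E /\
          (P (all_loads_ge d.+1 ball) <= (C * b ^+ n)%:E)%E.
Proof.
move=> da; have [] := tpoisson_lambdaP d alpha da.
move: (tpoisson_lambda alpha d.+1) => l l0 lmean /=.
have zgt0 := zeta_gt0 d.+1 l (ltW l0).
have zcvg := zeta_cvg d.+1 l (ltW l0).
have mcvg := tpoisson_mean_cvg d l (ltW l0).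
have meanE : l + (d`!%:R * tpoisson_zeta d.+1 l)^-1 = alpha.
  by have := lmean; rewrite tpoisson_meanE ?(ltW l0)// => -[].
rewrite meanE in mcvg.
set z := tpoisson_zeta d.+1 l in zgt0 zcvg mcvg *.
pose p j : R := z^-1 * (l ^+ j / (j + d.+1)`!%:R).
have p_gt0 j : 0 < p j.
  by rewrite mulr_gt0 ?invr_gt0// divr_gt0 ?exprn_gt0// ltr0n fact_gt0.
have mass : \sum_(j < N) p j @[N --> \oo] --> (1 : R).
  rewrite (_ : (fun N => _) =
      fun N => z^-1 * \sum_(j < N) l ^+ j / (j + d.+1)`!%:R); last first.
    by apply/funext => N; rewrite mulr_sumr.
  have : z^-1 * \sum_(j < N) l ^+ j / (j + d.+1)`!%:R @[N --> \oo] --> z^-1 * z.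
    by apply: cvgM; [exact: cvg_cst|exact: zcvg].
  by rewrite mulVf ?lt0r_neq0.
have mean : \sum_(j < N) p j * j%:R @[N --> \oo] --> alpha - d.+1%:R.
  rewrite (_ : (fun N => _) = fun N => \sum_(j < N) (j + d.+1)%:R * p j -
      d.+1%:R * \sum_(j < N) p j); last first.
    apply/funext => N; rewrite mulr_sumr -sumrB; apply: eq_bigr => j _.
    by rewrite natrD; ring.
  have : \sum_(j < N) (j + d.+1)%:R * p j - d.+1%:R * \sum_(j < N) p j
      @[N --> \oo] --> alpha - d.+1%:R * 1.
    by apply: cvgB => //; apply: cvgM => //; exact: cvg_cst.
  by rewrite mulr1.
(* From [j^2 <= 4^j] and [1 <= 4^j] follows [(j - mu)^2 <= (2 + 2 mu^2) 4^j], and the factor [4^j]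
   turns the series into zeta at [4 l]. *)
have [V var] : exists V, forall N,
    \sum_(j < N) p j * (j%:R - (alpha - d.+1%:R)) ^+ 2 <= V.
  move: (alpha - d.+1%:R) => mu.
  exists ((2 + 2 * mu ^+ 2) * (z^-1 * tpoisson_zeta d.+1 (4 * l))) => N.
  have l4 : 0 <= 4 * l by rewrite mulr_ge0// ltW.
  have mu2 : 0 <= 2 + 2 * mu ^+ 2 by have := sqr_ge0 mu; lra.
  have zi : 0 <= z^-1 by rewrite invr_ge0 ltW.
  apply: le_trans (ler_wpM2l mu2 (ler_wpM2l zi (zeta_partial_le d.+1 N _ l4))).
  rewrite !mulr_sumr; apply: ler_sum => j _.
  rewrite (_ : (2 + 2 * mu ^+ 2) * _ = p j * ((2 + 2 * mu ^+ 2) * 4 ^+ j)); last first.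
    rewrite /p exprMn; move: (4 ^+ j) (l ^+ j) (_`!%:R^-1) (z^-1) => *; ring.
  apply: ler_wpM2l; first exact: ltW.
  have j4 : j%:R ^+ 2 <= 4 ^+ j :> R.
    rewrite (_ : 4 = 2 ^+ 2) -?exprM ?[(2 * j)%N]mulnC ?exprM; last by ring.
    by rewrite lerXn2r ?nnegrE ?exprn_ge0// -natrX ler_nat ltnW// ltn_expl.
  have j1 : 1 <= 4 ^+ j :> R by rewrite exprn_ege1// ler1n.
  have := sqr_ge0 (j%:R + mu); have := sqr_ge0 mu; move: (4 ^+ j) j4 j1 => y j4 j1.
  nra.
have [c [C [c0 [C0 [n0 lim]]]]] :=
  @local_limit R p _ V (fun j => ltW (p_gt0 j)) (p_gt0 _) (p_gt0 _) mass mean var.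
have a0 : 0 < alpha by apply: lt_trans da; rewrite ltr0n.
have sa0 : 0 < Num.sqrt alpha by rewrite sqrtr_gt0.
pose c1 := expR 2^-1 * Num.sqrt alpha * c.
have c10 : 0 < c1 by rewrite !mulr_gt0 ?expR_gt0.
pose C1 := expR 1 * Num.sqrt alpha * C.
have C10 : 0 < C1 by rewrite !mulr_gt0 ?expR_gt0.
(* Adding [c1] makes the order of the two constants immediate. *)
exists c1, (C1 + c1); split=> //; split; first by rewrite lerDr ltW.
exists n0 => n m n_gt0 n0n mE disp T P ball throw.
have nR0 : 0 < n%:R :> R by rewrite ltr0n.
have m_gt0 : (0 < m)%N by rewrite -(ltr_nat R) mE mulr_gt0.
have dnm : (d.+1 * n <= m)%N.
  by rewrite -(ler_nat R) natrM mE ler_pM2r// ltW.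
pose k := (m - d.+1 * n)%N.
have kE : k%:R = (alpha - d.+1%:R) * n%:R by rewrite natrB// natrM mE; ring.
have [N mN] := lim n k m.+1 n0n n_gt0 kE.
rewrite /p coef_fact_series_scaled => /andP[lo hi].
have [slo shi] := andP (scaled_stirling _ _ _ m_gt0 n_gt0 mE).
rewrite (probability_all_loads_ge P _ _ _ _ throw).
rewrite (card_all_loads_ge n d.+1 k m N)//; last by rewrite subnKC.
set x := (fact_series _ _ ^+ _)`_k in lo hi *.
have lk0 : 0 < l ^+ k by rewrite exprn_gt0.
have zn0 : 0 < z ^+ n by rewrite exprn_gt0.
have bE : (alpha `^ alpha * z / (expR alpha * l `^ (alpha - d.+1%:R))) ^+ n =
    alpha ^+ m / expR m%:R * (z ^+ n / l ^+ k).
  rewrite expr_div_n !exprMn -expRM_natr -mE.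
  have -> : (alpha `^ alpha) ^+ n = alpha ^+ m.
    by rewrite -powR_mulrn ?powR_ge0// -powRrM -mE powR_mulrn// ltW.
  have -> : (l `^ (alpha - d.+1%:R)) ^+ n = l ^+ k.
    by rewrite -powR_mulrn ?powR_ge0// -powRrM -kE powR_mulrn// ltW.
  by rewrite mulf_div.
rewrite bE !lee_fin.
have sqE : Num.sqrt m%:R = Num.sqrt alpha * Num.sqrt n%:R :> R.
  by rewrite mE sqrtrM// ltW.
rewrite sqE in slo shi.
have sn0 : 0 < Num.sqrt n%:R :> R by rewrite sqrtr_gt0.
set G := z^-1 ^+ n * l ^+ k * x in lo hi.
(* The probability is a Stirling factor of order [sqrt n], the tilted coefficient [G] of order
   [1 / sqrt n], and the inverse of the tilt, which completes [b^n]. *)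
have -> : m`!%:R * x / n%:R ^+ m = m`!%:R / n%:R ^+ m * G * (z ^+ n / l ^+ k).
  rewrite /G exprVn; move: (n%:R ^+ m)^-1 => u.
  by field; rewrite !lt0r_neq0.
set F := m`!%:R / n%:R ^+ m in slo shi *.
set t := alpha ^+ m / expR m%:R in slo shi *.
have t0 : 0 <= t by rewrite divr_ge0 ?expR_ge0// exprn_ge0// ltW.
have r0 : 0 <= z ^+ n / l ^+ k by rewrite divr_ge0// ltW.
rewrite !(mulrA _ t (z ^+ n / l ^+ k)); split; apply: ler_wpM2r => //.
  rewrite (_ : c1 * t = expR 2^-1 * (Num.sqrt alpha * Num.sqrt n%:R * t) *
      (c / Num.sqrt n%:R)); last by rewrite /c1; field; rewrite lt0r_neq0.
  apply: ler_pM => //; last by rewrite divr_ge0// ltW.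
  by rewrite mulr_ge0 ?expR_ge0// mulr_ge0// mulr_ge0 ?sqrtr_ge0.
apply: (@le_trans _ _ (C1 * t)); last by rewrite ler_wpM2r// lerDl ltW.
rewrite (_ : C1 * t = expR 1 * (Num.sqrt alpha * Num.sqrt n%:R * t) *
    (C / Num.sqrt n%:R)); last by rewrite /C1; field; rewrite lt0r_neq0.
apply: ler_pM => //; first by rewrite divr_ge0.
by apply: le_trans lo; rewrite divr_ge0// ltW.
Qed.

Lemma all_loads_ge_critical {R : realType} (n d : nat) : (0 < n)%N -> (0 < d)%N ->
  let b : R := d%:R ^+ d / (expR d%:R * d`!%:R) in
  forall (disp : measure_display) (T : measurableType disp)
    (P : probability T R) (ball : 'I_(d * n) -> T -> 'I_n),
    random_throw P ball ->
    ((expR 2^-1 * (b ^+ n * Num.sqrt (d * n)%:R))%:E <= P (all_loads_ge d ball))%E /\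
    (P (all_loads_ge d ball) <= (expR 1 * (b ^+ n * Num.sqrt (d * n)%:R))%:E)%E.
Proof.
move=> n0 d0 b disp T P ball throw.
rewrite (probability_all_loads_ge P _ _ _ _ throw).
rewrite (card_all_loads_ge n d 0 (d * n) (d * n).+1) ?addn0//.
(* With [m = d n] only the constant coefficient matters, so Stirling's formula is the sole source of
   error and the constants are absolute. *)
have -> : (fact_series d (d * n).+1 ^+ n)`_0 = d`!%:R^-1 ^+ n :> R.
  by rewrite -horner_coef0 horner_exp horner_coef0 coef_poly add0n.
have dn0 : (0 < d * n)%N by rewrite muln_gt0 d0.
have := @scaled_stirling R _ n d%:R dn0 n0 (natrM _ _ _) => /=.
have -> : b ^+ n * Num.sqrt (d * n)%:R =
    Num.sqrt (d * n)%:R * (d%:R ^+ (d * n) / expR (d * n)%:R) * d`!%:R^-1 ^+ n.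
  rewrite /b expr_div_n exprMn -exprM natrM expRM_natr invfM exprVn mulrC.
  by rewrite !mulrA.
move=> /andP[lo hi]; rewrite !lee_fin [_`!%:R * _ / _]mulrAC.
have f0 : 0 <= d`!%:R^-1 ^+ n :> R by rewrite exprn_ge0// invr_ge0.
by rewrite !(mulrA (expR _) _ (d`!%:R^-1 ^+ n)); split; apply: ler_wpM2r.
Qed.

Theorem theorem1 (R : realType) :
  (forall (d : nat) (alpha : R), (0 < d)%N -> d%:R < alpha ->
    let lambda := tpoisson_lambda alpha d in
    let zeta := tpoisson_zeta d lambda in
    let b := (alpha `^ alpha * zeta) / (expR alpha * lambda `^ (alpha - d%:R)) in
    exists c C : R, 0 < c /\ c <= C /\
      exists N : nat, forall n m : nat,
        (0 < n)%N -> (N <= n)%N -> m%:R = alpha * n%:R ->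
        forall (disp : measure_display) (T : measurableType disp)
          (P : probability T R) (ball : 'I_m -> T -> 'I_n),
          random_throw P ball ->
          ((c * b ^+ n)%:E <= P (all_loads_ge d ball))%E /\
          (P (all_loads_ge d ball) <= (C * b ^+ n)%:E)%E)
  /\
  (exists c C : R, 0 < c /\ c <= C /\
    forall n d : nat, (0 < n)%N -> (0 < d)%N ->
      let b : R := d%:R ^+ d / (expR d%:R * d`!%:R) in
      forall (disp : measure_display) (T : measurableType disp)
        (P : probability T R) (ball : 'I_(d * n) -> T -> 'I_n),
        random_throw P ball ->
        ((c * (b ^+ n * Num.sqrt (d * n)%:R))%:E <= P (all_loads_ge d ball))%E /\
        (P (all_loads_ge d ball) <= (C * (b ^+ n * Num.sqrt (d * n)%:R))%:E)%E).
Proof.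
split=> [[//|d] alpha _|]; first exact: all_loads_ge_supercritical.
exists (expR 2^-1), (expR 1); split; first exact: expR_gt0.
split; first by rewrite ler_expR; lra.
by move=> n d n0 d0 b disp T P ball; exact: all_loads_ge_critical.
Qed.
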